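(* Let $0<l<d$ be integers and let $P=P_d(l)$ be the (2-level) min up/down polytope with parameter $l$, which has dimension $d$. Then $f_0(P)f_{d-1}(P)\leq d2^{d+1}$, and equality holds if and only if $P$ is affinely isomorphic to the $d$-dimensional cube or the $d$-dimensional cross-polytope.
   Context: For a $d$-dimensional polytope $P$, $f_0(P)$ is its number of vertices and $f_{d-1}(P)$ its number of facets. The $d$-dimensional cube is $[-1,1]^d$ and the $d$-dimensional cross-polytope is its polar. For $x\in\{0,1\}^d$, an index $i$ with $1\leq i\leq d-1$ is a switch index of $x$ if $x_i\neq x_{i+1}$. The vector $x$ satisfies the min up/down constraint with parameter $l$ if $j-i\geq l$ for any two switch indices $i<j$ of $x$. The min up/down polytope $P_d(l)$ is the convex hull of all vectors in $\{0,1\}^d$ satisfying the min up/down constraint with parameter $l$. (The polytopes $P_d(l)$ are what the paper calls 2-level min up/down polytopes.) *)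

(* Defs.v *)
From HB Require Import structures.
From mathcomp Require Import all_boot all_order all_algebra.
From mathcomp Require Import finmap.
From mathcomp Require Import boolp classical_sets functions cardinality reals.

Set Implicit Arguments.
Unset Strict Implicit.
Unset Printing Implicit Defensive.

Import Order.TTheory GRing.Theory Num.Theory.

Local Open Scope classical_set_scope.
Local Open Scope ring_scope.

(* Points of R^d are row vectors. *)

Definition dotp (R : realType) (d : nat) (a x : 'rV[R]_d) : R :=
  \sum_(i < d) a 0 i * x 0 i.

Definition convex_hull (R : realType) (d : nat) (S : set 'rV[R]_d) :
    set 'rV[R]_d :=
  [set x | exists (n : nat) (p : 'I_n -> 'rV[R]_d) (c : 'I_n -> R),
    [/\ forall i, S (p i), forall i, 0 <= c i,
        \sum_(i < n) c i = 1 & x = \sum_(i < n) c i *: p i]].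

Definition affine_hull (R : realType) (d : nat) (S : set 'rV[R]_d) :
    set 'rV[R]_d :=
  [set x | exists (n : nat) (p : 'I_n -> 'rV[R]_d) (c : 'I_n -> R),
    [/\ forall i, S (p i),
        \sum_(i < n) c i = 1 & x = \sum_(i < n) c i *: p i]].

(* The empty set has no dimension. *)
Definition has_dim (R : realType) (d : nat) (S : set 'rV[R]_d) (k : nat) :
    Prop :=
  exists (x : 'rV[R]_d) (U : {vspace 'rV[R]_d}),
    \dim U = k /\ affine_hull S = [set x + u | u in [set u | u \in U]].

(* With [a = 0] this includes the improper faces [P] and [set0]. *)
Definition is_face (R : realType) (d : nat) (P F : set 'rV[R]_d) : Prop :=
  exists (a : 'rV[R]_d) (b : R),
    (forall x, P x -> dotp a x <= b) /\ F = P `&` [set x | dotp a x = b].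

Definition faces (R : realType) (d : nat) (P : set 'rV[R]_d) (k : nat) :
    set (set 'rV[R]_d) :=
  [set F | is_face P F /\ has_dim F k].

(* Meaningful when [P] is a polytope: its set of faces is then finite, whereas
   [fset_set] sends an infinite set to [fset0]. *)
Definition face_number (R : realType) (d : nat) (k : nat)
    (P : set 'rV[R]_d) : nat :=
  #|` fset_set (faces P k)|.

(* Indices are numbered from 1: [a] and [b] are the 0-based positions of the
   coordinates x_i and x_(i+1), whose existence forces 1 <= i <= d - 1. *)
Definition switch_index (R : realType) (d : nat) (x : 'rV[R]_d) (i : nat) :
    Prop :=
  exists a b : 'I_d, [/\ a.+1 = i, b = i :> nat & x 0 a <> x 0 b].

Definition min_updown (R : realType) (d l : nat) (x : 'rV[R]_d) : Prop :=
  forall i j : nat, switch_index x i -> switch_index x j ->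
    (i < j)%N -> (l <= j - i)%N.

Definition min_updown_polytope (R : realType) (d l : nat) : set 'rV[R]_d :=
  convex_hull
    [set x : 'rV[R]_d | (forall i, x 0 i = 0 \/ x 0 i = 1) /\ min_updown l x].

Arguments min_updown_polytope : clear implicits.

Definition cube (R : realType) (d : nat) : set 'rV[R]_d :=
  [set x | forall i, -1 <= x 0 i <= 1].

Arguments cube : clear implicits.

Definition polar (R : realType) (d : nat) (P : set 'rV[R]_d) : set 'rV[R]_d :=
  [set y | forall x, P x -> dotp y x <= 1].

Definition cross_polytope (R : realType) (d : nat) : set 'rV[R]_d :=
  polar (cube R d).

Arguments cross_polytope : clear implicits.

(* The affine map is only required to be bijective between the two sets. *)
Definition affinely_isomorphic (R : realType) (m n : nat)
    (P : set 'rV[R]_m) (Q : set 'rV[R]_n) : Prop :=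
  exists (A : 'M[R]_(m, n)) (b : 'rV[R]_n), set_bij P Q (fun x => x *m A + b).

(* Main.v *)
Require Import Defs.
From HB Require Import structures.
From mathcomp Require Import all_boot all_order all_algebra reals.
From mathcomp Require Import finmap boolp classical_sets functions cardinality.
From mathcomp Require Import zify ring lra.

(** Write [d = n + 1], so that a point has [n] places where it may switch. The
    vertices of the polytope [P] are the admissible 0/1 points: the first
    entry is free, and the switch pattern is one of the [s] bit strings of
    length [n] whose ones are at least [l] apart. This gives [2 s] vertices,
    with [s(n + 1) = s(n) + s(n - (l - 1))].

    The facets come from alternating forms. For a bit string [e] of length [n]
    the form [x_n - \sum_j e_j (x_(j+1) - x_j)] has coefficients [e_j -
    e_(j-1)] (with [e_(-1) = 0] and [e_n = 1]): its nonzero coefficients are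
    alternately 1 and -1 and begin and end with 1. Call [e] narrow when every
    zero lying after a one is less than [l] places away from it. The form then
    only sees a window of [l + 1] consecutive entries, where an admissible
    point switches at most once, so its values on [P] lie between 0 and 1. The
    two extreme values cut out two facets, and distinct narrow strings give
    distinct facets: the steps (0, ..., 0, 1, ..., 1) and their complements
    are vertices, one of each complementary pair lies on each of the two
    facets, and which one it is recovers [e] (lemmas [alt_slice_facet] and
    [alt_slice_inj]).

    There are no other facets because these inequalities describe [P]
    ([polytope_alt_formP]). Choosing [e] as the indicator of the increasing
    steps of [x] inside a window, they say that the total increase of [x] over
    at most [l] consecutive steps is at most the entry reached at the end, and
    dually for [1 - x]. Write such an [x] as [U - W], where [U] and [W]
    accumulate the increases and the decreases. For every threshold [theta]
    the integer sequence [ceil (U - theta) - ceil (W - theta)] is an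
    admissible 0/1 sequence, and its average over [theta] in [0, 1] is [x];
    the average is a finite one because only the fractional parts of [U] and
    [W] matter. Now if no form were constant at 0 or 1 on a facet, averaging
    witnesses would give a point of the facet where all inequalities are
    strict, and [P] would extend beyond the facet ([tight_alt_form]).

    Counting narrow strings gives [(n - l + 2) 2^l] facets, and an induction
    yields [s (n - l + 2) <= (n + 1) 2^(n - l + 1)], with equality only for [l
    = 1] or [l = n] ([dwell_count_bound]). For [l = 1] the polytope is the
    unit cube and for [l = n] it is a cross-polytope. Conversely an affine
    bijection preserves the number of extreme points, so a polytope isomorphic
    to one of these two has [s = 2^n] or [s = n + 1], which forces [l = 1] or
    [l = n]. *)

Set Implicit Arguments.
Unset Strict Implicit.
Unset Printing Implicit Defensive.

Import Order.TTheory GRing.Theory Num.Theory.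

(** * Counting bit strings *)

Definition bit_count (n : nat) (p : pred bitseq) : nat :=
  #|[set t : n.-tuple bool | p t]%SET|.

Lemma bit_count0 (p : pred bitseq) : bit_count 0 p = p [::].
Proof.
rewrite /bit_count; case: (boolP (p [::])) => p0.
  rewrite (_ : [set _ | _]%SET = finset.setT) ?cardsT ?card_tuple //.
  by apply/setP => t; rewrite !inE tuple0.
rewrite (_ : [set _ | _]%SET = finset.set0) ?cards0 //.
by apply/setP => t; rewrite !inE tuple0; apply: negbTE.
Qed.

Lemma bit_countS (n : nat) (p : pred bitseq) :
  bit_count n.+1 p =
  bit_count n (fun s => p (true :: s)) + bit_count n (fun s => p (false :: s)).
Proof.
have inj_cons b : injective (fun t : n.-tuple bool => cons_tuple b t).
  by move=> s t /(congr1 val)[] /val_inj.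
have imE b : bit_count n (fun s => p (b :: s)) =
    #|[set t : n.+1.-tuple bool | p t & thead t == b]%SET|.
  rewrite /bit_count -(card_imset _ (inj_cons b)); apply/eq_card => t.
  rewrite !inE; apply/imsetP/andP => [[s]|[]].
    by rewrite inE => ps ->; split=> //=; rewrite theadE.
  case/tupleP: t => c s; rewrite theadE => ps /eqP cb.
  by exists s; rewrite ?inE -cb.
rewrite !imE /bit_count.
rewrite -[LHS](cardsID [set t : n.+1.-tuple bool | thead t]%SET).
by congr (_ + _); apply/eq_card => t; rewrite !inE; case: (thead t);
  rewrite ?andbT ?andbF //= andbC.
Qed.

Lemma eq_bit_count (n : nat) (p q : pred bitseq) :
  p =1 q -> bit_count n p = bit_count n q.
Proof. by move=> pq; apply/eq_card => t; rewrite !inE pq. Qed.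

(** Tests whether [s] may continue a string whose last value is [c] and which
    has to keep this value for [k] more entries before it may switch. *)
Fixpoint dwells (l k : nat) (c : bool) (s : bitseq) : bool :=
  if s is b :: s' then
    if b == c then dwells l k.-1 c s' else (k == 0) && dwells l l.-1 b s'
  else true.

Definition vertex_bits (l : nat) (t : bitseq) : bool :=
  if t is c :: s then dwells l 0 c s else true.

(** A zero may follow the first one only among the next [l - 1] bits; this
    bounds the window of entries that occur in the alternating form of [e]. *)
Fixpoint narrow (l : nat) (e : bitseq) : bool :=
  if e is b :: e' then if b then all id (drop l.-1 e') else narrow l e'
  else true.

(** The entries of rank [i] in [c :: s] and in [s] are consecutive in the
    whole string, so that [i] is a switch when they differ. *)
Lemma dwellsP (l k : nat) (c : bool) (s : bitseq) : 0 < l ->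
  let switch i := i < size s /\ nth c (c :: s) i != nth c s i in
  reflect ((forall i, switch i -> k <= i) /\
           (forall i j, switch i -> switch j -> i < j -> l <= j - i))
          (dwells l k c s).
Proof.
move=> l_gt0; elim: s k c => [|b s IHs] k c /=.
  by apply: ReflectT; split=> [i []|i j []].
have nthE i : i < size s -> nth c s i = nth b s i.
  by move=> si; apply: set_nth_default.
have nthE' i : i < (size s).+1 -> nth c (b :: s) i = nth b (b :: s) i.
  by move=> si; apply: set_nth_default.
have [bc | b_c] := eqVneq b c.
  rewrite bc; apply: (iffP (IHs _ _)) => -[H1 H2]; split.
  - by move=> [|i] [] //=; rewrite ?eqxx // => si sw; have := H1 i; lia.
  - move=> [|i] [|j] [] //=; rewrite ?eqxx // => si swi [sj swj] ij.
    by rewrite subSS; apply: H2.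
  - by move=> i [si sw]; have := H1 i.+1 (conj si sw); lia.
  - move=> i j [si swi] [sj swj] ij.
    by have := H2 i.+1 j.+1 (conj si swi) (conj sj swj); rewrite subSS; apply.
apply: (iffP andP) => [[/eqP -> /IHs[H1 H2]] | [H1 H2]].
- split=> // -[|i] [|j] [] //= si swi [sj swj] ij.
    rewrite nthE // nthE' ?(ltnW sj) // in swj.
    by have := H1 j (conj sj swj); lia.
  rewrite nthE // nthE' ?(ltnW si) // in swi.
  rewrite nthE // nthE' ?(ltnW sj) // in swj.
  by rewrite subSS; apply: H2.
have sw0 : 0 < (size s).+1 /\ c != b by rewrite eq_sym.
split; first by have := H1 0 sw0; rewrite leqn0.
apply/IHs; split=> [i [si sw] | i j [si swi] [sj swj] ij].
  have := H2 0 i.+1 sw0; rewrite /= nthE // nthE' ?ltnS ?(ltnW si) //.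
  by move=> /(_ (conj si sw) isT); lia.
have := H2 i.+1 j.+1; rewrite /= !nthE // !nthE' ?ltnS ?(ltnW si) ?(ltnW sj) //.
by rewrite subSS; apply.
Qed.

Lemma narrowP (l : nat) (e : bitseq) : 0 < l ->
  reflect (forall i j, i < j < size e ->
             nth false e i -> ~~ nth false e j -> j - i < l)
          (narrow l e).
Proof.
move=> l_gt0; elim: e => [|b e IHe] /=.
  by apply: ReflectT => i j; rewrite ltn0 andbF.
case: b; last first.
  apply: (iffP IHe) => [H [|i] [|j] //= ij ei ej | H i j ij ei ej].
    by rewrite subSS; apply: H.
  by have := H i.+1 j.+1; rewrite subSS; apply.
apply: (iffP (all_nthP false)) => [H i [|j] //= | H j].
  rewrite ltnS => /andP[ij je] _ ej; rewrite ltnNge; apply: contra ej => lij.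
  have lj : l.-1 <= j by lia.
  by rewrite -(subnKC lj) -nth_drop H // size_drop; lia.
rewrite size_drop => je; rewrite nth_drop; apply/negPn/negP => ej.
by have := H 0 (l.-1 + j).+1 _ isT ej; lia.
Qed.

Lemma bit_count_drop (n k : nat) :
  bit_count n (fun s => all id (drop k s)) = 2 ^ minn n k.
Proof.
elim: n k => [|n IHn] k; first by rewrite bit_count0 /= min0n.
rewrite bit_countS; case: k => [|k] /=.
  have -> : bit_count n (fun=> false) = 0.
    by apply: eq_card0 => t; rewrite !inE.
  have := IHn 0; rewrite !minn0 addn0 => <-.
  by apply: eq_bit_count => s; rewrite drop0.
by rewrite IHn minnSS expnS mul2n addnn.
Qed.

Lemma bit_count_narrowS (l n : nat) :
  bit_count n.+1 (narrow l.+1) = 2 ^ minn n l + bit_count n (narrow l.+1).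
Proof. by rewrite bit_countS /= bit_count_drop. Qed.

Lemma bit_count_narrow (l m : nat) :
  bit_count (l.+1 + m) (narrow l.+1) = m.+2 * 2 ^ l.
Proof.
have small n : n <= l.+1 -> bit_count n (narrow l.+1) = 2 ^ n.
  elim: n => [|n IHn] ln; first by rewrite bit_count0.
  rewrite bit_count_narrowS IHn ?(ltnW ln) // (minn_idPl _) //.
  by rewrite addnn -mul2n expnS.
elim: m => [|m IHm]; first by rewrite addn0 small // expnS.
rewrite addnS bit_count_narrowS IHm (minn_idPr _); last by lia.
by rewrite -mulSn.
Qed.

Lemma bit_count_dwells_color (l n k : nat) (c : bool) :
  bit_count n (dwells l k c) = bit_count n (dwells l k true).
Proof.
case: c => //; elim: n k => [|n IHn] k; first by rewrite !bit_count0.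
rewrite !bit_countS /= addnC !IHn; case: k => [|k] //=.
by rewrite IHn.
Qed.

(** A forced entry leaves no choice. *)
Lemma bit_count_dwells_wait (l n k : nat) :
  bit_count n (dwells l k true) = bit_count (n - k) (dwells l 0 true).
Proof.
elim: k n => [|k IHk] n; first by rewrite subn0.
case: n => [|n]; first by rewrite !bit_count0.
rewrite bit_countS /= subSS -IHk [X in _ + X](_ : _ = 0) ?addn0 //.
by apply: eq_card0 => t; rewrite !inE.
Qed.

(** For [l > 0], the number of switch patterns: the bit strings of length [n]
    whose ones are at least [l] apart. *)
Definition dwell_count (l n : nat) : nat := bit_count n (dwells l 0 true).

Lemma dwell_countS (l n : nat) :
  dwell_count l.+1 n.+1 = dwell_count l.+1 n + dwell_count l.+1 (n - l).
Proof.
by rewrite /dwell_count bit_countS /= (bit_count_dwells_color _ _ _ false)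
  (bit_count_dwells_wait _ _ l).
Qed.

Lemma dwell_count0 (l : nat) : dwell_count l 0 = 1.
Proof. by rewrite /dwell_count bit_count0. Qed.

Lemma bit_count_vertex (l n : nat) :
  bit_count n.+1 (vertex_bits l) = 2 * dwell_count l n.
Proof.
by rewrite bit_countS /= (bit_count_dwells_color _ _ _ false) addnn mul2n.
Qed.

Lemma dwell_count_le (l n : nat) : dwell_count l n <= 2 ^ n.
Proof.
have <- : #|{: n.-tuple bool}| = 2 ^ n by rewrite card_tuple card_bool.
exact: max_card.
Qed.

Lemma dwell_count_small (l n : nat) : n <= l.+1 -> dwell_count l.+1 n = n.+1.
Proof.
elim: n => [|n IHn] nl; first by rewrite dwell_count0.
rewrite dwell_countS IHn ?(ltnW nl) // (_ : n - l = 0) ?dwell_count0 ?addn1 //.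
by lia.
Qed.

Lemma dwell_count1 (n : nat) : dwell_count 1 n = 2 ^ n.
Proof.
elim: n => [|n IHn]; first by rewrite dwell_count0.
by rewrite dwell_countS subn0 IHn addnn expnS mul2n.
Qed.

(** The bound on [f_0 f_(d-1)] after division by a power of two. In the
    inductive step the recurrence adds [dwell_count l.+1 m.+1] strings, and
    the crude bound [2 ^ m.+1] on this number already makes the inequality
    strict, with a margin of [(m + 1) l 2^(m+1)] once denominators are
    cleared. *)
Lemma dwell_count_bound (l m : nat) :
  dwell_count l.+1 (l.+1 + m) * m.+2 <= (l + m).+2 * 2 ^ m.+1
    ?= iff (l == 0) || (m == 0).
Proof.
apply/leqifP; have [-> /=|l_gt0 /=] := posnP l.
  by rewrite dwell_count1 add0n add1n mulnC.
elim: m => [|m IHm] /=.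
  by rewrite !addn0 dwell_count_small // mulnC.
have tm : dwell_count l.+1 (l.+1 + m) * m.+2 <= (l + m).+2 * 2 ^ m.+1.
  by case: ifP IHm => _ => [/eqP-> | /ltnW].
have sm := dwell_count_le l.+1 m.+1.
rewrite addnS dwell_countS (_ : l.+1 + m - l = m.+1); last by lia.
rewrite -(ltn_pmul2r (ltn0Sn m.+1)) expnS.
have : 0 < 2 ^ m.+1 by rewrite expn_gt0.
move: (dwell_count _ _) (dwell_count _ _) (2 ^ _) tm sm => a b c tm sm c_gt0.
have H1 := leq_mul (leqnn m.+3) tm.
have H2 := leq_mul (leqnn (m.+2 * m.+3)) sm.
nia.
Qed.

(** Switch patterns with two adjacent ones are excluded. *)
Lemma dwell_count_lt (l n : nat) : 1 < l <= n -> dwell_count l n < 2 ^ n.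
Proof.
case: l n => [|[|l]] // [|n] //= ln; rewrite dwell_countS.
have := dwell_count_le l.+2 n; have := dwell_count_le l.+2 (n - l.+1).
have : 2 ^ (n - l.+1) < 2 ^ n by rewrite ltn_exp2l //; lia.
by rewrite expnS; lia.
Qed.

(** Besides the [n + 1] switch patterns with at most one one, some pattern
    with two ones is allowed. *)
Lemma dwell_count_gt (l n : nat) : 0 < l < n -> n.+1 < dwell_count l n.
Proof.
case: l n => [|l] // [|n] //= ln; rewrite dwell_countS.
have gt0 m : 0 < dwell_count l.+1 m.
  by elim: m => [|m IHm]; rewrite ?dwell_count0 // dwell_countS addn_gt0 IHm.
have ge m : m < dwell_count l.+1 m.
  elim: m => [|m IHm]; first by rewrite dwell_count0.
  by rewrite dwell_countS; have := gt0 (m - l); lia.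
by have := ge n; have := ge (n - l); lia.
Qed.

(** * Sequences with bounded rises and their rounding *)

Section Rounding.
Local Open Scope ring_scope.
Variable R : realType.
Implicit Types (f : nat -> R) (n l : nat).

Definition rise f (j : nat) : R := Num.max (f j.+1 - f j) 0.

Definition flip f (j : nat) : R := 1 - f j.

Lemma rise_ge0 f j : 0 <= rise f j.
Proof. by rewrite /rise le_max lexx orbT. Qed.

Lemma rise_flip f j : rise f j - rise (flip f) j = f j.+1 - f j.
Proof.
rewrite /rise /flip (_ : 1 - _ - _ = - (f j.+1 - f j)); last by ring.
by case: (lerP 0 (f j.+1 - f j)) => fj; case: (lerP 0 (- _)) => fj'; lra.
Qed.

(** For a 0/1 sequence this says that an up-switch is followed by no
    down-switch within fewer than [l] steps. *)
Definition rises_bounded n l f : Prop :=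
  forall r s, (r <= s <= n)%N -> (s - r <= l)%N ->
    \sum_(r <= j < s) rise f j <= f s.

Definition windowed n l f : Prop :=
  rises_bounded n l f /\ rises_bounded n l (flip f).

(** [f] is the difference of the two nondecreasing sequences [ascent f] and
    [descent f]. *)
Definition ascent f (j : nat) : R := f 0%N + \sum_(0 <= i < j) rise f i.
Definition descent f (j : nat) : R := \sum_(0 <= i < j) rise (flip f) i.

Lemma ascentB f j : ascent f j - descent f j = f j.
Proof.
rewrite /ascent /descent; elim: j => [|j IHj].
  by rewrite !big_geq // subr0 addr0.
rewrite !big_nat_recr //=; have := rise_flip f j; lra.
Qed.

Lemma ascent_sum f r s : (r <= s)%N ->
  ascent f s = ascent f r + \sum_(r <= j < s) rise f j.
Proof. by move=> rs; rewrite /ascent (@big_cat_nat _ _ _ r 0) //= addrA. Qed.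

Lemma descent_sum f r s : (r <= s)%N ->
  descent f s = descent f r + \sum_(r <= j < s) rise (flip f) j.
Proof. by move=> rs; rewrite /descent (@big_cat_nat _ _ _ r 0). Qed.

Lemma le_ascent f r s : (r <= s)%N -> ascent f r <= ascent f s.
Proof.
by move=> rs; rewrite (ascent_sum _ rs) lerDl sumr_ge0 // => *; apply: rise_ge0.
Qed.

Lemma le_descent f r s : (r <= s)%N -> descent f r <= descent f s.
Proof.
move=> rs; rewrite (descent_sum _ rs) lerDl sumr_ge0 // => j _.
exact: rise_ge0.
Qed.

Lemma rises_bounded_ge0 n l f j : rises_bounded n l f -> (j <= n)%N -> 0 <= f j.
Proof.
move=> bf jn; have := bf j j; rewrite big_geq // leqnn subnn; exact.
Qed.

Lemma windowed_01 n l f j : windowed n l f -> (j <= n)%N -> 0 <= f j <= 1.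
Proof.
move=> [bf bg] jn; have := rises_bounded_ge0 bg jn.
rewrite /flip subr_ge0 => ->.
by rewrite (rises_bounded_ge0 bf jn).
Qed.

(** Together with [ascent_le_descent], this is what keeps opposite switches of
    a rounded sequence apart. *)
Lemma descent_le_ascent n l f r s : windowed n l f ->
  (r <= s <= n)%N -> (s - r <= l)%N -> descent f s <= ascent f r.
Proof.
move=> [bf _] rsn sr; have /andP[rs sn] := rsn.
have := bf _ _ rsn sr; rewrite -(ascentB f s) (ascent_sum f rs); lra.
Qed.

Lemma ascent_le_descent n l f r s : windowed n l f ->
  (r <= s <= n)%N -> (s - r <= l)%N -> ascent f s <= descent f r + 1.
Proof.
move=> [_ bg] rsn sr; have /andP[rs sn] := rsn.
have := bg _ _ rsn sr; rewrite /flip -(ascentB f s) (descent_sum f rs); lra.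
Qed.

(** Counts how many thresholds [theta], [theta + 1], ... have been passed by
    [ascent f] but not yet by [descent f]. *)
Definition round (theta : R) f (j : nat) : int :=
  Num.ceil (ascent f j - theta) - Num.ceil (descent f j - theta).

Lemma ceilD1 (x : R) : Num.ceil (x + 1) = Num.ceil x + 1.
Proof. by rewrite ceilDrz ?ceil1 // rpred1. Qed.

Lemma round01 theta n l f j : windowed n l f -> (j <= n)%N ->
  round theta f j = 0 \/ round theta f j = 1.
Proof.
move=> wf jn; rewrite /round.
have jjn : (j <= j <= n)%N by rewrite leqnn.
have jj : (j - j <= l)%N by rewrite subnn.
have lo := descent_le_ascent wf jjn jj.
have hi := ascent_le_descent wf jjn jj.
have := le_ceil (lerB lo (lexx theta)).
have := le_ceil (lerB hi (lexx theta)).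
rewrite (addrAC (descent f j) 1) ceilD1.
by move: (Num.ceil _) (Num.ceil _) => a b; lia.
Qed.

(** If the rounding switches on at [t], then [ascent] has passed a threshold
    that it had not passed at time [t], hence that [descent] does not pass
    before the window ends; switching off is similar. *)
Lemma round_stay theta n l f s t : windowed n l f ->
  (t < s <= n)%N -> (s - t <= l)%N ->
  round theta f t <> round theta f t.+1 ->
  round theta f s = round theta f t.+1.
Proof.
move=> wf /andP[ts sn] st.
have tsn : (t <= s <= n)%N by lia.
have := round01 theta wf (ltnW (leq_trans ts sn)).
have := round01 theta wf (leq_trans ts sn).
have := round01 theta wf sn; rewrite /round.
have := le_ceil (lerB (descent_le_ascent wf tsn st) (lexx theta)).
have := le_ceil (lerB (ascent_le_descent wf tsn st) (lexx theta)).
rewrite (addrAC (descent f t) 1) ceilD1.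
have := le_ceil (lerB (le_ascent f ts) (lexx theta)).
have := le_ceil (lerB (le_descent f ts) (lexx theta)).
have := le_ceil (lerB (le_ascent f (leqnSn t)) (lexx theta)).
have := le_ceil (lerB (le_descent f (leqnSn t)) (lexx theta)).
move: (Num.ceil (ascent f s - _)) (Num.ceil (descent f s - _)) => us ws.
move: (Num.ceil (ascent f t - _)) (Num.ceil (descent f t - _)) => ut wt.
move: (Num.ceil (ascent f t.+1 - _)) (Num.ceil (descent f t.+1 - _)) => u w.
by lia.
Qed.

Lemma round_gap theta n l f s t : windowed n l f -> (t < s < n)%N ->
  round theta f t <> round theta f t.+1 ->
  round theta f s <> round theta f s.+1 -> (l <= s - t)%N.
Proof.
move=> wf /andP[ts sn] sw_t sw_s; rewrite leqNgt; apply/negP => st; apply: sw_s.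
rewrite (round_stay wf _ _ sw_t) ?ts ?(ltnW sn) ?(ltnW st) //.
by rewrite (round_stay wf _ _ sw_t) ?sn ?(ltnW ts) ?subSn ?(ltnW ts) //; lia.
Qed.

Lemma ceil_threshold (theta u : R) : 0 <= theta < 1 ->
  Num.ceil (u - theta) = Num.floor u + (theta < u - (Num.floor u)%:~R)%R%:Z.
Proof.
move=> /andP[t0 t1]; have /andP[] := floor_itv u; rewrite intrD => lo hi.
by apply: ceil_def; case: (ltP theta) => /= h; rewrite !intrD ?intrN /=; lra.
Qed.

(** A finite substitute for the uniform measure on [0, 1): the elements of
    [B], sorted and preceded by 0, are the thresholds, and each is weighted by
    the distance to the next one. For [b] in [B] the weights of the thresholds
    below [b] telescope to [b]. *)
Lemma threshold_weights (B : seq R) : all (fun b => 0 <= b < 1) B ->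
  exists (N : nat) (theta lambda : 'I_N -> R),
    [/\ forall k, 0 <= theta k < 1, forall k, 0 <= lambda k,
        \sum_k lambda k = 1 &
        forall b, b \in B -> \sum_k lambda k * (theta k < b)%R%:R = b].
Proof.
move=> /allP B01; pose s := 0 :: sort <=%R B.
have sB b : b \in s -> 0 <= b < 1.
  rewrite inE mem_sort => /orP[/eqP-> |]; last exact: B01.
  by rewrite lexx ltr01.
have s1 k : nth 1 s k <= 1.
  have [ks | ks] := ltnP k (size s); last by rewrite nth_default.
  by have /andP[_ /ltW] := sB _ (mem_nth 1 ks).
have ss : sorted <=%R s.
  rewrite /= path_min_sorted; first exact: (sort_sorted (@le_total _ _)).
  by apply/allP => b; rewrite mem_sort => /B01/andP[].
have le_s : {homo nth 1 s : i j / (i <= j)%N >-> i <= j}.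
  move=> i j ij; have [js | js] := ltnP j (size s); last first.
    by rewrite [leRHS]nth_default.
  apply: (sorted_leq_nth le_trans le_refl 1 ss) => //; rewrite inE.
  exact: leq_ltn_trans js.
exists (size s), (fun k => nth 1 s k), (fun k => nth 1 s k.+1 - nth 1 s k).
split=> [k|k||b bB].
- exact/sB/mem_nth.
- by rewrite subr_ge0 le_s.
- rewrite -(big_mkord xpredT (fun k => nth 1 s k.+1 - nth 1 s k)).
  by rewrite telescope_sumr // nth_default // subr0.
have bs : b \in s by rewrite inE mem_sort bB orbT.
have kb : (index b s <= size s)%N by rewrite index_size.
rewrite -(big_mkord xpredT
  (fun k => (nth 1 s k.+1 - nth 1 s k) * (nth 1 s k < b)%R%:R)).
rewrite (big_cat_nat (leq0n _) kb) //= [X in _ + X]big1_seq ?addr0; last first.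
  move=> k /andP[_]; rewrite mem_index_iota => /andP[bk _].
  by rewrite -[b in (_ < b)](nth_index 1 bs) ltNge le_s // mulr0.
rewrite (eq_big_nat _ _ (F2 := fun k => nth 1 s k.+1 - nth 1 s k)).
  by rewrite telescope_sumr // nth_index // subr0.
move=> k /andP[_ kb']; have := le_s _ _ kb'; rewrite nth_index //.
have := le_s _ _ (leqnSn k); case: (ltP (nth 1 s k) b) => h h1 h2 /=.
  by rewrite mulr1.
by rewrite mulr0; lra.
Qed.

End Rounding.

(** * Alternating forms *)

Section Forms.
Local Open Scope ring_scope.
Variable R : realType.
Implicit Types (f : nat -> R) (n l : nat) (e : bitseq).

Definition alternating n e f : R :=
  f n - \sum_(0 <= j < n) (nth false e j)%:R * (f j.+1 - f j).

Lemma alternating_flip n e f :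
  alternating n e (flip f) = 1 - alternating n e f.
Proof.
rewrite /alternating /flip [X in _ - X](_ : _ =
  - \sum_(0 <= j < n) (nth false e j)%:R * (f j.+1 - f j)); first by ring.
by rewrite -sumrN; apply: eq_bigr => j _; ring.
Qed.

(** Let [r] be the place of the first one of [e] and [s = min (r + l, n)]. The
    bits of [e] vanish before [r] and equal 1 from [s] on, so the form reduces
    to [f s] minus some of the steps between [r] and [s], which are at most
    the rises there. *)
Lemma alternating_ge0 n l e f : (0 < l)%N -> size e = n -> narrow l e ->
  rises_bounded n l f -> 0 <= alternating n e f.
Proof.
move=> l_gt0 sz /(narrowP _ l_gt0) ne bf.
pose r := find id e; pose s := minn (r + l) n.
have rn : (r <= n)%N by rewrite -sz find_size.
have rs : (r <= s)%N by rewrite /s; lia.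
have sn : (s <= n)%N by rewrite /s; lia.
have sr : (s - r <= l)%N by rewrite /s; lia.
have fs := bf r s; rewrite rs sn in fs; have {}fs := fs isT sr.
rewrite /alternating.
rewrite (big_cat_nat (leq0n s) sn) //= (big_cat_nat (leq0n r) rs) //=.
rewrite big_nat_cond big1 ?add0r; last first.
  by move=> j /andP[/andP[_ jr] _]; rewrite (before_find false jr) mul0r.
rewrite [X in _ - (_ + X)](_ : _ = f n - f s); last first.
  rewrite -(telescope_sumr f sn); apply: eq_big_nat => j /andP[sj jn].
  have rj : (r + l <= j)%N by move: sj; rewrite /s; lia.
  suff -> : nth false e j by rewrite mul1r.
  apply/negPn/negP => ej.
  have er : nth false e r.
    by rewrite (nth_find false (a := id)) // has_find -/r sz; lia.
  by have := ne r j _ er ej; rewrite sz; lia.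
suff : \sum_(r <= j < s) (nth false e j)%:R * (f j.+1 - f j) <= f s by lra.
apply: le_trans fs; apply: ler_sum => j _; rewrite /rise le_max.
by case: nth; rewrite ?mul1r ?mul0r lexx ?orbT.
Qed.

(** The bits [b] select the rising steps of the window from [r] to [s], so
    that the form is [f s] minus the sum of the rises. *)
Lemma alternating_rises n l f : (0 < l)%N ->
  (forall e, size e = n -> narrow l e -> 0 <= alternating n e f) ->
  rises_bounded n l f.
Proof.
move=> l_gt0 ge0 r s /andP[rs sn] sr.
(* Zeros before [r], ones from [s] on: narrow because [s - r <= l]. *)
pose b j := (s <= j)%N || ((r <= j)%N && (0 < f j.+1 - f j)).
have bE j : (j < n)%N -> nth false (mkseq b n) j = b j.
  by move=> jn; rewrite nth_mkseq.
have := ge0 (mkseq b n); rewrite size_mkseq => /(_ erefl).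
have ne : narrow l (mkseq b n).
  apply/narrowP => // i j; rewrite size_mkseq => /andP[ij jn].
  rewrite !bE ?(ltn_trans ij) // /b; case: (_ < _); case: (_ < _); lia.
move=> /(_ ne); rewrite /alternating.
rewrite (big_cat_nat (leq0n s) sn) //= (big_cat_nat (leq0n r) rs) //=.
rewrite big_nat_cond big1 ?add0r; last first.
  move=> j /andP[/andP[_ jr] _]; rewrite bE; last by lia.
  by rewrite /b leqNgt (leq_trans jr rs) leqNgt jr mul0r.
rewrite [X in _ - (_ + X)](_ : _ = f n - f s); last first.
  rewrite -(telescope_sumr f sn); apply: eq_big_nat => j /andP[sj jn].
  by rewrite bE // /b sj mul1r.
rewrite (eq_big_nat _ _ (F2 := rise f)); first by lra.
move=> j /andP[rj js]; rewrite bE; last by lia.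
rewrite /b leqNgt js rj /rise /=.
case: (ltP 0 (f j.+1 - f j)) => h /=.
  by rewrite mul1r.
by rewrite mul0r.
Qed.

Lemma windowedP n l f : (0 < l)%N ->
  windowed n l f <->
  (forall e, size e = n -> narrow l e -> 0 <= alternating n e f <= 1).
Proof.
move=> l_gt0; split=> [[bf bg] e sz ne | H].
  have := alternating_ge0 l_gt0 sz ne bg.
  rewrite alternating_flip subr_ge0 => ->.
  by rewrite (alternating_ge0 l_gt0 sz).
split; apply: alternating_rises => // e sz ne; have /andP[] := H e sz ne => //.
by move=> _ le1; rewrite alternating_flip subr_ge0.
Qed.

(** By induction on [s]: the sum can only fail to stay below [f s] at a
    down-switch, and then no up-switch occurs in the window. *)
Lemma rises_bounded01 n l f :
  (forall j, (j <= n)%N -> f j = 0 \/ f j = 1) ->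
  (forall t s, (t < s < n)%N -> f t <> f t.+1 -> f s <> f s.+1 ->
     (l <= s - t)%N) ->
  rises_bounded n l f.
Proof.
move=> f01 gap r s; elim: s => [|s IHs] /andP[rs sn] sr.
  by rewrite big_geq //; have [//|->|->] := f01 0%N; rewrite ?lexx ?ler01.
have [rs' | sr'] := leqP r s; last first.
  by rewrite big_geq //; have [//|->|->] := f01 s.+1; rewrite ?lexx ?ler01.
have := f01 _ (ltnW sn); have := f01 _ sn.
have {}IHs : \sum_(r <= j < s) rise f j <= f s by apply: IHs; lia.
rewrite big_nat_recr //= /rise; case=> fs1 [] fs0; rewrite fs0 fs1 in IHs *.
- by rewrite subrr maxxx addr0.
- rewrite big_nat_cond big1 ?add0r; first by rewrite ge_max ?sub0r lerN10 lexx.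
  move=> j /andP[/andP[rj js] _]; apply/max_idPr.
  have [-> // | /eqP fj] := eqVneq (f j) (f j.+1); first by rewrite subrr.
  have := gap j s; rewrite js sn fs0 fs1 => /(_ isT fj).
  have : (1 : R) <> 0 by apply/eqP; rewrite oner_eq0.
  by move=> h /(_ h); lia.
- by rewrite subr0 max_l ?ler01 //; lra.
- by rewrite subrr maxxx addr0.
Qed.

End Forms.

(** * The polytope is cut out by the alternating forms *)

Section Vectors.
Local Open Scope classical_set_scope.
Local Open Scope ring_scope.
Variables (R : realType) (n : nat).
Implicit Types (x : 'rV[R]_n.+1) (l : nat).

(** Natural number indices let entries be used as sequences; only indices up
    to [n] are meaningful. *)
Definition entry x (j : nat) : R := x 0 (inord j).

Lemma entry_ord x (i : 'I_n.+1) : entry x i = x 0 i.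
Proof. by rewrite /entry inord_val. Qed.

Lemma entry_row (f : nat -> R) j : (j <= n)%N ->
  entry (\row_i f i) j = f j.
Proof. by move=> jn; rewrite /entry mxE inordK. Qed.

Lemma entryP x (y : 'rV[R]_n.+1) :
  (forall j, (j <= n)%N -> entry x j = entry y j) -> x = y.
Proof.
by move=> xy; apply/rowP => i; rewrite -!entry_ord xy // -ltnS ltn_ord.
Qed.

Definition updown_points l : set 'rV[R]_n.+1 :=
  [set x : 'rV[R]_n.+1 | (forall i, x 0 i = 0 \/ x 0 i = 1) /\ min_updown l x].

Lemma updown_pointsP l x : updown_points l x <->
  (forall j, (j <= n)%N -> entry x j = 0 \/ entry x j = 1) /\
  (forall t s, (t < s < n)%N -> entry x t <> entry x t.+1 ->
     entry x s <> entry x s.+1 -> (l <= s - t)%N).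
Proof.
have sw_i t : (t < n)%N -> entry x t <> entry x t.+1 -> switch_index x t.+1.
  move=> tn sw; exists (inord t), (inord t.+1).
  by rewrite !inordK //; lia.
split=> -[x01 gap].
  split=> [j _|t s /andP[ts sn] swt sws]; first exact: x01.
  have := gap t.+1 s.+1 (sw_i _ (ltn_trans ts sn) swt) (sw_i _ sn sws).
  by rewrite subSS; apply.
split=> [i|i j]; first by rewrite -entry_ord; apply: x01; rewrite -ltnS.
move=> [a [a' [<- aa' swa]]] [b [b' [<- bb' swb]]]; rewrite ltnS subSS => ab.
have bn : (b < n)%N by rewrite -ltnS -bb'.
by apply: gap; rewrite ?ab // ?entry_ord -?aa' -?bb' entry_ord.
Qed.

(** Typed in the regular module so that it is a linear map between vector
    spaces, whose kernel has a dimension. *)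
Definition alt_form (e : bitseq) x : R^o := alternating n e (entry x).

Fact alt_form_is_linear e : linear (alt_form e).
Proof.
move=> a x y; rewrite /alt_form /alternating /entry !mxE.
rewrite scalerBr [X in _ = X]addrACA -opprD; congr (_ + _ - _).
rewrite scaler_sumr -big_split /=; apply: eq_bigr => j _; rewrite !mxE.
by rewrite /GRing.scale /=; ring.
Qed.
HB.instance Definition _ e :=
  GRing.isLinear.Build R 'rV[R]_n.+1 R^o _ (alt_form e) (alt_form_is_linear e).

Lemma alt_form_flip e x : alt_form e (const_mx 1 - x) = 1 - alt_form e x.
Proof.
rewrite -alternating_flip /alt_form /alternating; congr (_ - _).
  by rewrite /entry !mxE.
by apply: eq_bigr => j _; rewrite /entry !mxE.
Qed.

Lemma updown_points_windowed l x : updown_points l x -> windowed n l (entry x).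
Proof.
move=> /updown_pointsP[x01 gap]; split; apply: rises_bounded01 => //.
  by move=> j /x01; rewrite /flip => -[]->; [right; ring | left; ring].
by move=> t s ts swt sws; apply: gap => // E; [apply: swt | apply: sws];
  rewrite /flip E.
Qed.

(** The floor of [u] does not depend on the threshold, and the average of the
    remaining indicator is the fractional part of [u]. *)
Lemma sum_ceil N (theta lambda : 'I_N -> R) (u : R) :
  (forall k, 0 <= theta k < 1) -> \sum_k lambda k = 1 ->
  \sum_k lambda k * (theta k < u - (Num.floor u)%:~R)%R%:R =
    u - (Num.floor u)%:~R ->
  \sum_k lambda k * (Num.ceil (u - theta k))%:~R = u.
Proof.
move=> th1 lam1 lamu.
rewrite (eq_bigr (fun k => lambda k * (Num.floor u)%:~R +
  lambda k * (theta k < u - (Num.floor u)%:~R)%R%:R)).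
  by rewrite big_split /= lamu -mulr_suml lam1; ring.
by move=> k _; rewrite ceil_threshold // intrD mulrDr.
Qed.

(** The thresholds are adapted to the fractional parts of all values of
    [ascent] and [descent]; the rounded sequences are then vertices averaging
    to [x]. *)
Lemma windowed_hull l x : windowed n l (entry x) ->
  min_updown_polytope R n.+1 l x.
Proof.
move=> wx; pose frac (u : R) := u - (Num.floor u)%:~R.
pose B := [seq frac (ascent (entry x) j) | j <- iota 0 n.+1] ++
          [seq frac (descent (entry x) j) | j <- iota 0 n.+1].
have B01 : all (fun b => 0 <= b < 1) B.
  have frac01 u : 0 <= frac u < 1.
    by have := floor_itv u; rewrite intrD /frac; lra.
  by rewrite all_cat; apply/andP; split; apply/allP => _ /mapP[j _ ->].
have [N [theta [lambda [th1 lam0 lam1 lamB]]]] := threshold_weights B01.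
exists N, (fun k => \row_i (round (theta k) (entry x) i)%:~R), lambda.
split=> // [k|].
  apply/updown_pointsP; split=> [j jn | t s /andP[ts sn]].
    rewrite (entry_row (fun j => (round (theta k) (entry x) j)%:~R)) //.
    by have [->|->] := round01 (theta k) wx jn; [left|right].
  rewrite !(entry_row (fun j => (round (theta k) (entry x) j)%:~R)); try by lia.
  move=> swt sws; apply: (round_gap wx (theta := theta k)); rewrite ?ts ?sn //.
    by move=> E; apply: swt; rewrite E.
  by move=> E; apply: sws; rewrite E.
apply: entryP => j jn; rewrite {2}/entry summxE.
under eq_bigr => k _ do rewrite !mxE inordK //.
under eq_bigr => k _ do rewrite /round intrB mulrBr.
by rewrite sumrB !sum_ceil ?ascentB //; apply: lamB; rewrite mem_cat;
  apply/orP; [right | left]; apply/mapP; exists j; rewrite // mem_iota.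
Qed.

Lemma alt_form_hull (S : set 'rV[R]_n.+1) e x :
  (forall y, S y -> 0 <= alt_form e y <= 1) -> convex_hull S x ->
  0 <= alt_form e x <= 1.
Proof.
move=> Se [N [p [c [Sp c0 c1 ->]]]]; rewrite linear_sum /=.
under eq_bigr do rewrite linearZ /=.
apply/andP; split.
  apply: sumr_ge0 => k _; apply: mulr_ge0; first exact: c0.
  by have /andP[] := Se _ (Sp k).
rewrite -c1; apply: ler_sum => k _; apply: ler_piMr => //.
by have /andP[] := Se _ (Sp k).
Qed.

Lemma polytope_windowed l x : (0 < l)%N ->
  min_updown_polytope R n.+1 l x <-> windowed n l (entry x).
Proof.
move=> l_gt0; split; last exact: windowed_hull.
move=> Px; apply/windowedP => // e sz ne; apply: alt_form_hull Px => y Vy.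
exact: ((windowedP _ _ l_gt0).1 (updown_points_windowed Vy)).
Qed.

End Vectors.

(** * Hulls, dimension and extreme points *)

Section Hulls.
Local Open Scope classical_set_scope.
Local Open Scope ring_scope.
Variables (R : realType) (d : nat).
Implicit Types (S T : set 'rV[R]_d) (a x : 'rV[R]_d).

Fact dotp_is_scalar a : scalar (dotp a).
Proof.
move=> k x y; rewrite /dotp mulr_sumr -big_split /=; apply: eq_bigr => i _.
by rewrite !mxE; ring.
Qed.
HB.instance Definition _ a :=
  GRing.isLinear.Build R 'rV[R]_d R *%R (dotp a) (dotp_is_scalar a).

Lemma dotpN a x : dotp (- a) x = - dotp a x.
Proof. by rewrite /dotp -sumrN; apply: eq_bigr => i _; rewrite mxE mulNr. Qed.

Lemma dotp_gt0 a : a != 0 -> 0 < dotp a a.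
Proof.
have sq_ge0 i : 0 <= a 0 i * a 0 i by rewrite -expr2 sqr_ge0.
move=> a0; rewrite lt0r sumr_ge0 ?andbT //.
apply: contra a0; rewrite psumr_eq0 => [/allP H | //].
apply/eqP/rowP => i; rewrite mxE; apply/eqP.
by have := H i; rewrite mem_index_enum mulf_eq0 orbb; apply.
Qed.

Lemma linear_dotp (f : {linear 'rV[R]_d -> R^o}) x :
  f x = dotp (\row_i f (delta_mx 0 i)) x.
Proof.
rewrite {1}(row_sum_delta x) linear_sum; apply: eq_bigr => i _.
by rewrite linearZ mxE mulrC.
Qed.

Lemma sub_convex_hull S : S `<=` convex_hull S.
Proof.
move=> x Sx; exists 1%N, (fun=> x), (fun=> 1).
by split=> //; rewrite big_ord1 ?scale1r.
Qed.

Lemma sub_affine_hull S : S `<=` affine_hull S.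
Proof.
move=> x Sx; exists 1%N, (fun=> x), (fun=> 1).
by split=> //; rewrite big_ord1 ?scale1r.
Qed.

Lemma affine_hullS S T : S `<=` T -> affine_hull S `<=` affine_hull T.
Proof.
by move=> ST _ [N [p [c [Sp c1 ->]]]]; exists N, p, c; split=> // i; apply: ST.
Qed.

Lemma affine_hull0 : affine_hull (set0 : set 'rV[R]_d) = set0.
Proof.
rewrite -subset0 => x [[|N] [p [c [Sp c1 _]]]]; last exact: (Sp ord0).
by move: c1 => /eqP; rewrite big_ord0 eq_sym oner_eq0.
Qed.

(** When 0 is available, the coefficients need not sum to 1: the origin takes
    the missing weight. *)
Lemma affine_hull_origin S (I : finType) (p : I -> 'rV[R]_d) (c : I -> R) :
  S 0 -> (forall i, S (p i)) -> affine_hull S (\sum_i c i *: p i).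
Proof.
move=> S0 Sp; exists (#|I|.+1),
  (fun k => if unlift ord0 k is Some i then p (enum_val i) else 0),
  (fun k => if unlift ord0 k is Some i then c (enum_val i)
            else 1 - \sum_i c i).
split=> [k||].
- by case: unlift.
- rewrite big_ord_recl unlift_none (eq_bigr (c \o enum_val)) => [|i _].
    by rewrite [in 1 - _](reindex _ (onW_bij _ (enum_val_bij I))) /= subrK.
  by rewrite liftK.
- rewrite big_ord_recl unlift_none scaler0 add0r.
  rewrite [RHS](eq_bigr (fun i => c (enum_val i) *: p (enum_val i))) => [|i _].
    by rewrite (reindex _ (onW_bij _ (enum_val_bij I))).
  by rewrite liftK.
Qed.

Lemma affine_hull_hyperplane S a b :
  S `<=` [set x | dotp a x = b] -> affine_hull S `<=` [set x | dotp a x = b].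
Proof.
move=> Sab _ [N [p [c [Sp c1 ->]]]] /=; rewrite linear_sum /=.
under eq_bigr do rewrite linearZ /= (Sab _ (Sp _)).
by rewrite -mulr_suml c1 mul1r.
Qed.

Lemma flat_sub x y (U W : {vspace 'rV[R]_d}) :
  [set x + u | u in [set u | u \in U]] `<=`
    [set y + w | w in [set w | w \in W]] ->
  (U <= W)%VS /\ exists2 w, w \in W & x = y + w.
Proof.
move=> sub; have [w0 /= w0W xE] : [set y + w | w in [set w | w \in W]] x.
  by apply: sub; exists 0; rewrite /= ?mem0v ?addr0.
split; last by exists w0.
apply/subvP => u uU; have [|w /= wW wE] := sub (x + u); first by exists u.
suff -> : u = w - w0 by rewrite rpredB.
by apply: (addrI x); rewrite -wE -xE addrACA subrr addr0.
Qed.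

Lemma has_dim_uniq S j k : has_dim S j -> has_dim S k -> j = k.
Proof.
move=> [x [U [<- hU]]] [y [W [<- hW]]]; suff -> : U = W by [].
apply/eqP; rewrite eqEsubv.
by rewrite (@flat_sub x y U W _).1 ?(@flat_sub y x W U _).1 // -hU -hW.
Qed.

(** Nested sets of the same dimension span the same flat; this turns an
    inclusion between facets into an equality. *)
Lemma affine_hull_eq S T k : has_dim S k -> has_dim T k -> S `<=` T ->
  affine_hull S = affine_hull T.
Proof.
move=> [x [U [dU hS]]] [y [W [dW hT]]] ST.
have := affine_hullS ST; rewrite hS hT => /flat_sub[UW [w0 w0W ->]].
have -> : U = W by apply/eqP; rewrite eqEdim UW dU dW /=.
apply/seteqP; split=> _ [u /= uW <-].
  by exists (w0 + u); rewrite /= ?rpredD // addrA.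
by exists (u - w0); rewrite /= ?rpredB // addrACA subrr addr0.
Qed.

(** Affine bijections between convex sets preserve extreme points directly,
    whereas for faces one would have to transport supporting hyperplanes. *)
Definition extreme S : set 'rV[R]_d :=
  [set x | S x /\ forall (t : R) y z, 0 < t < 1 -> S y -> S z ->
    x = (1 - t) *: y + t *: z -> y = z].

(** If [p i] has a weight strictly between 0 and 1, then [x] lies strictly
    between [p i] and the barycenter [q] of the other points, which are
    therefore equal. *)
Lemma extreme_hull S : extreme (convex_hull S) `<=` S.
Proof.
move=> x [[N [p [c [Sp c0 c1 xE]]]] ext].
have [i ci] : exists i, 0 < c i.
  apply: contrapT => nc; move: c1; rewrite big1 => [/esym/eqP|i _].
    by rewrite oner_eq0.
  apply/eqP; rewrite eq_le c0 andbT leNgt; apply/negP => ci.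
  by apply: nc; exists i.
have c1i : c i + \sum_(j | j != i) c j = 1 by rewrite -c1 [RHS](bigD1 i).
have [ci1 | ci1] := eqVneq (c i) 1.
  have cj j : j != i -> c j = 0.
    have : \sum_(j | j != i) c j = 0 by move: c1i; rewrite ci1; lra.
    by move=> /psumr_eq0P; apply.
  suff -> : x = p i by [].
  rewrite xE (bigD1 i) //= ci1 scale1r big1 ?addr0 // => j /cj ->.
  by rewrite scale0r.
have {ci1} ci1 : c i < 1.
  by rewrite lt_neqAle ci1 -c1i lerDl sumr_ge0.
pose q := \sum_j ((if j == i then 0 else c j) / (1 - c i)) *: p j.
have Sq : convex_hull S q.
  exists N, p, (fun j => (if j == i then 0 else c j) / (1 - c i)); split=> //.
    by move=> j; apply: divr_ge0; [case: ifP | rewrite subr_ge0 ltW].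
  rewrite -mulr_suml (bigD1 i) //= eqxx add0r.
  rewrite (eq_bigr c) => [|j /negbTE -> //].
  rewrite (_ : \sum_(j | j != i) c j = 1 - c i).
    by rewrite divff // subr_eq0 gt_eqF.
  by rewrite -c1i addrC addKr.
have xpq : x = (1 - c i) *: q + c i *: p i.
  rewrite xE (bigD1 i) //= addrC; congr (_ + _).
  rewrite /q [in RHS](bigD1 i) //= eqxx mul0r scale0r add0r scaler_sumr.
  apply: eq_bigr => j /negbTE ->; rewrite scalerA mulrC divfK //.
  by rewrite subr_eq0 gt_eqF.
have qp : q = p i.
  by apply: (ext (c i)) => //; [rewrite ci ci1 | exact: sub_convex_hull].
by rewrite xpq qp -scalerDl subrK scale1r.
Qed.

End Hulls.

Section FiniteSets.
Local Open Scope classical_set_scope.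

Lemma card_fset_image (T : finType) (U : choiceType) (f : T -> U)
    (A : {set T}) : {in A &, injective f} ->
  #|` fset_set [set f x | x in [set x | x \in A]]| = #|A|.
Proof.
move=> f_inj.
have -> : [set f x | x in [set x | x \in A]] = [set` [fset f x | x in A]%fset].
  apply/seteqP; split=> y /=.
    by move=> [x xA <-]; apply/imfsetP; exists x.
  by move=> /imfsetP[x /= xA ->]; exists x.
by rewrite set_fsetK card_in_imfset //= -cardE.
Qed.

End FiniteSets.

Section SmallStep.
Local Open Scope ring_scope.

(** Finitely many strict inequalities survive a small displacement. *)
Lemma small_step (R : realFieldType) (T : finType) (g h : T -> R) :
  (forall t, 0 < g t) ->
  exists2 eps : R, 0 < eps & forall t, eps * h t <= g t.
Proof.
move=> g0; pose S := \sum_t `|h t| / g t.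
have S_ge0 : 0 <= S by apply: sumr_ge0 => t _; rewrite divr_ge0 // ltW.
have S1 : 0 < 1 + S by rewrite addrC ltr_wpDl.
(* Adding 1 keeps the denominator positive when [h] vanishes. *)
exists (1 + S)^-1 => [|t]; first by rewrite invr_gt0.
rewrite mulrC ler_pdivrMr // mulrDr mulr1.
have : `|h t| / g t <= S.
  rewrite /S (bigD1 t) //= lerDl sumr_ge0 // => u _.
  by rewrite divr_ge0 // ltW.
rewrite ler_pdivrMr // mulrC => le_hS; apply: le_trans (ler_norm _) _.
by apply: le_trans le_hS _; rewrite lerDr ltW.
Qed.

End SmallStep.

(** * The facets given by the alternating forms *)

Section Faces.
Local Open Scope classical_set_scope.
Local Open Scope ring_scope.
Variables (R : realType) (n : nat).
Implicit Types (x a : 'rV[R]_n.+1) (e : bitseq) (l : nat).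
Local Notation P l := (min_updown_polytope R n.+1 l).

Definition tail (i : nat) : 'rV[R]_n.+1 := \row_j (i <= j)%N%:R.

Lemma entry_tail i j : (j <= n)%N -> entry (tail i) j = (i <= j)%N%:R.
Proof. by move=> jn; rewrite (entry_row (fun j => (i <= j)%N%:R)). Qed.

Lemma entry_flip x j : entry (const_mx 1 - x) j = 1 - entry x j.
Proof. by rewrite /entry !mxE. Qed.

Lemma updown_points_tail l i : updown_points l (tail i).
Proof.
apply/updown_pointsP; split=> [j jn | t s /andP[ts sn]].
  by rewrite entry_tail //; case: leqP; [right | left].
rewrite !entry_tail; try by lia.
move=> swt sws.
have ti : ~ (i <= t)%N by move=> it; apply: swt; rewrite it leqW.
have si : (i <= t.+1)%N.
  rewrite leqNgt; apply/negP => h; apply: swt.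
  by rewrite (leqNgt i t.+1) h; case: leqP.
by case: sws; rewrite (leq_trans si ts) (leq_trans si (leqW ts)).
Qed.

Lemma updown_points_flip l x :
  updown_points l x -> updown_points l (const_mx 1 - x).
Proof.
move=> /updown_pointsP[x01 gap]; apply/updown_pointsP.
split=> [j /x01 | t s tsn].
  by rewrite entry_flip => -[]->; [right | left]; rewrite ?subr0 ?subrr.
rewrite !entry_flip => swt sws; apply: gap => // E; [apply: swt|apply: sws];
by rewrite E.
Qed.

Lemma polytope_flip l x : P l x -> P l (const_mx 1 - x).
Proof.
move=> [N [p [c [Sp c0 c1 ->]]]]; exists N, (fun k => const_mx 1 - p k), c.
split=> // [k|]; first exact: (updown_points_flip (Sp k)).
under [RHS]eq_bigr do rewrite scalerBr.
by rewrite sumrB -scaler_suml c1 scale1r.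
Qed.

Lemma flip_vecK x : const_mx 1 - (const_mx 1 - x) = x.
Proof. by rewrite opprB addrC subrK. Qed.

Lemma polytope_alt_formP l x : (0 < l)%N -> P l x <->
  forall e, size e = n -> narrow l e -> 0 <= alt_form e x <= 1.
Proof.
by move=> l_gt0; rewrite (polytope_windowed _ l_gt0); apply: windowedP.
Qed.

Lemma polytope_entry l x j : (0 < l)%N -> P l x -> (j <= n)%N ->
  0 <= entry x j <= 1.
Proof. by move=> l_gt0 /(polytope_windowed _ l_gt0); apply: windowed_01. Qed.

Lemma sum_tails (c : nat -> R) :
  \sum_(i < n.+1) c i *: tail i = \row_j \sum_(0 <= i < j.+1) c i.
Proof.
apply/rowP => j; rewrite summxE mxE big_mkord.
rewrite (big_ord_widen n.+1 (fun i => c i)) ?ltn_ord // [RHS]big_mkcond /=.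
by apply: eq_bigr => i _; rewrite !mxE ltnS; case: leqP; rewrite ?mulr1 ?mulr0.
Qed.

Lemma tail0 : tail 0 = const_mx 1.
Proof. by apply/rowP => j; rewrite !mxE. Qed.

(** Any point is a linear combination of the steps [tail i], with its
    successive differences as coefficients. *)
Lemma polytope_full l : has_dim (P l) n.+1.
Proof.
exists 0, fullv; split; first by rewrite dimvf /dim /= mul1n.
apply/seteqP; split=> x _; first by exists x; rewrite /= ?memvf // add0r.
(* The entry preceding the first one counts as 0. *)
pose c i := entry x i - (if i is i'.+1 then entry x i' else 0).
have -> : x = \sum_(i < n.+1) c i *: tail i.
  rewrite sum_tails; apply/rowP => j; rewrite mxE -entry_ord.
  elim: (j : nat) => [|k IHk]; first by rewrite big_nat1 /c subr0.
  by rewrite big_nat_recr //= -IHk /c addrC subrK.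
apply: affine_hull_origin => [|i]; apply: sub_convex_hull; last first.
  exact: updown_points_tail.
by have := updown_points_flip (updown_points_tail l 0); rewrite tail0 subrr.
Qed.

(** For [l > 0] and a narrow [e] of length [n] these are facets of the
    polytope. *)
Definition alt_slice l e (c : bool) : set 'rV[R]_n.+1 :=
  P l `&` [set x | alt_form e x = c%:R].

Lemma alt_form_tail0 e : alt_form e (tail 0) = 1.
Proof.
rewrite /alt_form /alternating big_nat_cond big1 => [|j /andP[/andP[_ jn] _]].
  by rewrite subr0 entry_tail.
by rewrite !entry_tail ?(ltnW jn) // subrr mulr0.
Qed.

(** Only the step at place [i] contributes, so the vertices [tail i.+1] read
    off the bits of [e]. *)
Lemma alt_form_tailS e i : (i < n)%N ->
  alt_form e (tail i.+1) = 1 - (nth false e i)%:R.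
Proof.
move=> i_n; rewrite /alt_form /alternating entry_tail // i_n; congr (_ - _).
rewrite (bigD1_seq i) ?mem_index_iota ?iota_uniq //= big1_seq => [|j].
  by rewrite !entry_tail ?(ltnW i_n) // ltnSn ltnn subr0 mulr1 addr0.
rewrite mem_index_iota => /andP[ji jn].
rewrite !entry_tail ?(ltnW jn) //.
rewrite ltnS leq_eqVlt eq_sym (negbTE ji) /=.
by case: ltnP => _; rewrite subrr mulr0.
Qed.

Lemma alt_slice_flip l e c x :
  alt_slice l e c x -> alt_slice l e (~~ c) (const_mx 1 - x).
Proof.
move=> [Px fx]; split; first exact: polytope_flip.
by rewrite /= alt_form_flip fx; case: c {fx}; rewrite ?subrr ?subr0.
Qed.

(** For each place [i], either [tail i.+1] or its complement lies in the
    slice. Both have a single step, at [i], so with suitable signs the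
    differences of [x] are the coefficients of [x] on these points; the
    equation of the hyperplane accounts for the constant part. *)
Lemma affine_hull_alt_slice0 l e x :
  alt_form e x = 0 -> affine_hull (alt_slice l e false) x.
Proof.
move=> fx.
pose w i := if nth false e i then tail i.+1 else const_mx 1 - tail i.+1.
pose c i := (entry x i.+1 - entry x i) * (if nth false e i then 1 else -1).
have -> : x = \sum_(i < n) c i *: w i.
  apply: entryP => j jn; rewrite [RHS]/entry summxE.
  have cE (i : 'I_n) : (c i *: w i) 0 (inord j) =
      (if (i < j)%N then entry x i.+1 - entry x i else 0) -
      (entry x i.+1 - entry x i) +
      (nth false e i)%:R * (entry x i.+1 - entry x i).
    rewrite mxE /c /w; case: nth; rewrite ?mxE inordK //=.
      by case: ltnP => _ /=; ring.
    by case: ltnP => _ /=; ring.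
  under eq_bigr do rewrite cE.
  rewrite big_split sumrB /=.
  rewrite -(big_mkord xpredT (fun i => entry x i.+1 - entry x i)).
  rewrite -(big_mkord xpredT
    (fun i => (nth false e i)%:R * (entry x i.+1 - entry x i))).
  rewrite -big_mkcond /=.
  rewrite -(big_ord_widen n (fun i => entry x i.+1 - entry x i)) //.
  rewrite -(big_mkord xpredT (fun i => entry x i.+1 - entry x i)).
  rewrite !(telescope_sumr (entry x)) //.
  by move: fx; rewrite /alt_form /alternating; lra.
apply: affine_hull_origin => [|i].
  split; last by rewrite /= linear0.
  rewrite -(subrr (const_mx 1)) -tail0; apply: sub_convex_hull.
  by rewrite {1}tail0; apply/updown_points_flip/updown_points_tail.
rewrite /w; case: ifP => ei; split=> /=.
- exact/sub_convex_hull/updown_points_tail.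
- by rewrite alt_form_tailS // ei subrr.
- exact/sub_convex_hull/updown_points_flip/updown_points_tail.
- by rewrite alt_form_flip alt_form_tailS // ei subr0 subrr.
Qed.

(** The slice at 1 is the image of the slice at 0 under [x |-> 1 - x]. *)
Lemma affine_hull_alt_slice l e c :
  affine_hull (alt_slice l e c) = [set x | alt_form e x = c%:R].
Proof.
apply/seteqP; split.
  have formE x : alt_form e x = dotp (\row_i alt_form e (delta_mx 0 i)) x.
    exact: linear_dotp.
  move=> x /affine_hull_hyperplane H /=; rewrite formE.
  by apply: H => y [_] /=; rewrite formE.
case: c => x /=; last exact: affine_hull_alt_slice0.
move=> fx; have : affine_hull (alt_slice l e false) (const_mx 1 - x).
  by apply: affine_hull_alt_slice0; rewrite alt_form_flip fx subrr.
move=> [N [p [c [Sp c1 xE]]]]; exists N, (fun k => const_mx 1 - p k), c.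
split=> // [k|]; first exact: (alt_slice_flip (Sp k)).
under eq_bigr do rewrite scalerBr.
by rewrite sumrB -scaler_suml c1 scale1r -xE flip_vecK.
Qed.

Lemma alt_slice_dim l e c : has_dim (alt_slice l e c) n.
Proof.
exists (c%:R *: tail 0), (lker (linfun (alt_form e))); split; last first.
  rewrite affine_hull_alt_slice; apply/seteqP; split=> x /=.
    move=> fx; exists (x - c%:R *: tail 0); last by rewrite addrC subrK.
    rewrite /= memv_ker lfunE linearB linearZ /= fx alt_form_tail0.
    by rewrite [_ *: _]mulr1 subrr.
  move=> [u]; rewrite /= memv_ker lfunE => /eqP /= fu <-.
  by rewrite linearD linearZ /= fu alt_form_tail0 addr0 [_ *: _]mulr1.
have := limg_ker_dim (linfun (@alt_form R n e)) fullv.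
rewrite capvC capvf dimvf [dim _]/= /dim /= mul1n => dimE.
suff limg1 : \dim (limg (linfun (@alt_form R n e))) = 1%N.
  by move: dimE; rewrite limg1 addn1 => -[].
apply/eqP; rewrite eqn_leq; apply/andP; split.
  by rewrite (leq_trans (dimvS (subvf _))) // dimvf.
rewrite lt0n dimv_eq0; apply/eqP => im0.
have := memv_img (linfun (alt_form e)) (memvf (tail 0)).
by rewrite im0 lfunE /= alt_form_tail0 memv0 oner_eq0.
Qed.

Lemma alt_slice_facet l e c : (0 < l)%N -> size e = n -> narrow l e ->
  faces (P l) n (alt_slice l e c).
Proof.
move=> l_gt0 sz ne; split; last exact: alt_slice_dim.
pose a : 'rV[R]_n.+1 := \row_i alt_form e (delta_mx 0 i).
have formE x : alt_form e x = dotp a x by exact: linear_dotp.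
exists (if c then a else - a), c%:R; split=> [x Px|].
  have := (polytope_alt_formP _ l_gt0).1 Px e sz ne.
  by rewrite formE; case: c; rewrite ?dotpN ?oppr_le0 => /andP[].
rewrite /alt_slice; congr (_ `&` _); apply/seteqP; split=> x /=; rewrite formE;
  case: c; rewrite ?dotpN //.
  by move=> ->; rewrite oppr0.
by move=> /eqP; rewrite oppr_eq0 => /eqP.
Qed.

(** The slice contains [tail 0] exactly when [c = 1], and [tail i.+1] exactly
    when [e_i] differs from [c]. *)
Lemma alt_slice_inj l e e' c c' : size e = n -> size e' = n ->
  alt_slice l e c = alt_slice l e' c' -> (e, c) = (e', c').
Proof.
move=> sz sz' E.
have tailE i : (i <= n)%N ->
    (alt_form e (tail i) = c%:R) <-> (alt_form e' (tail i) = c'%:R).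
  move=> i_n; have Pt : P l (tail i).
    exact/sub_convex_hull/updown_points_tail.
  split=> h; first by have : alt_slice l e' c' (tail i); [rewrite -E | case].
  by have : alt_slice l e c (tail i); [rewrite E | case].
have natR_inj (b b' : bool) : (b%:R = b'%:R :> R) -> b = b'.
  by move=> /eqP; rewrite eqr_nat; case: b; case: b'.
have oneR (b : bool) : (1 = b%:R :> R) <-> b.
  by split=> [|->] //; rewrite (_ : 1 = true%:R) // => /natR_inj <-.
have cc : c = c'.
  have := tailE 0%N isT; rewrite !alt_form_tail0 !oneR; clear.
  by case: c; case: c' => -[] // h h'; [apply/esym/h | apply/h'].
rewrite cc; congr (_, _).
apply: (@eq_from_nth _ false) => [|i]; first by rewrite sz.
rewrite sz => i_n; have := tailE i.+1 i_n; rewrite !alt_form_tailS // -cc.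
have subE (b b' : bool) : (1 - b%:R = b'%:R :> R) <-> b' = ~~ b.
  split=> [h | ->]; last by case: b; rewrite ?subrr ?subr0.
  by apply: natR_inj; rewrite -h; case: b {h}; rewrite ?subrr ?subr0.
rewrite !subE; clear E tailE cc.
by case: nth; case: nth; case: c => -[] // h h';
  first [by have := h erefl | by have := h' erefl].
Qed.

End Faces.

(** * Classification and number of vertices and facets *)

Section Classification.
Local Open Scope classical_set_scope.
Local Open Scope ring_scope.
Variables (R : realType) (n l : nat).
Hypothesis l_gt0 : (0 < l)%N.
Implicit Types (x a : 'rV[R]_n.+1).
Local Notation P := (min_updown_polytope R n.+1 l).

(** Otherwise each inequality is strict at some point of [F]. All inequalities
    are then strict at the average [p] of these points, so that [p] can be
    moved slightly in the direction [a] inside the polytope, where [dotp a]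
    exceeds [b]. *)
Lemma tight_alt_form a b (F : set 'rV[R]_n.+1) :
  a != 0 -> (forall x, P x -> dotp a x <= b) ->
  F = P `&` [set x | dotp a x = b] -> F !=set0 ->
  exists (e : n.-tuple bool) (c : bool), narrow l e /\ F `<=` alt_slice l e c.
Proof.
move=> a0 ab FE [x0 Fx0]; apply: contrapT => nF.
have zP (t : n.-tuple bool * bool) : exists x, F x /\
    (narrow l t.1 -> alt_form t.1 x <> t.2%:R).
  have [ne | _] := boolP (narrow l t.1); last by exists x0.
  apply: contrapT => nz; apply: nF; exists t.1, t.2; split=> // x Fx.
  split=> /=; first by move: Fx; rewrite FE => -[].
  by apply: contrapT => nx; apply: nz; exists x.
have [z zF] := choice zP.
pose T := (n.-tuple bool * bool)%type; pose m : R := #|{: T}|%:R.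
have m_gt0 : 0 < m.
  by rewrite ltr0n; apply/card_gt0P; exists ([tuple of nseq n true], true).
have m_neq0 : m != 0 by rewrite gt_eqF.
pose p := m^-1 *: \sum_t z t.
have fp (f : {scalar 'rV[R]_n.+1}) : f p = m^-1 * \sum_t f (z t).
  by rewrite linearZ linear_sum.
have fp' e : alt_form e p = m^-1 * \sum_t alt_form e (z t).
  by rewrite linearZ linear_sum.
have zPP t : P (z t) by have := (zF t).1; rewrite FE => -[].
have apb : dotp a p = b.
  rewrite fp (eq_bigr (fun=> b)) => [|t _]; last first.
    by have := (zF t).1; rewrite FE => -[].
  by rewrite sumr_const -[b *+ _]mulr_natl mulrA mulVf ?mul1r.
have z01 (e : n.-tuple bool) t : narrow l e -> 0 <= alt_form e (z t) <= 1.
  move=> ne; apply: ((polytope_alt_formP _ l_gt0).1 (zPP t)) => //.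
  by rewrite size_tuple.
have p_gt0 (e : n.-tuple bool) : narrow l e -> 0 < alt_form e p.
  move=> ne; rewrite fp' mulr_gt0 ?invr_gt0 // (bigD1 (e, false)) //=.
  rewrite ltr_wpDr //.
    by apply: sumr_ge0 => t _; have /andP[] := z01 e t ne.
  rewrite lt0r; have /andP[-> _] := z01 e (e, false) ne; rewrite andbT.
  by apply/eqP; apply: (zF (e, false)).2.
have p_lt1 (e : n.-tuple bool) : narrow l e -> 0 < 1 - alt_form e p.
  move=> ne; have -> : 1 - alt_form e p = m^-1 * \sum_t (1 - alt_form e (z t)).
    by rewrite sumrB sumr_const mulrBr mulVf // -fp'.
  rewrite mulr_gt0 ?invr_gt0 // (bigD1 (e, true)) //= ltr_wpDr //.
    by apply: sumr_ge0 => t _; have /andP[_] := z01 e t ne; rewrite subr_ge0.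
  rewrite lt0r subr_ge0; have /andP[_ ->] := z01 e (e, true) ne.
  rewrite andbT subr_eq0.
  by apply/eqP => /esym; apply: (zF (e, true)).2.
(* The slack of each inequality at [p] and its rate of decrease along [a]; the
   value 1 is a placeholder for strings that are not narrow. *)
pose g (t : T) := if narrow l t.1 then
  (if t.2 then 1 - alt_form t.1 p else alt_form t.1 p) else 1.
pose h (t : T) : R := if t.2 then alt_form t.1 a else - alt_form t.1 a.
have g_gt0 t : 0 < g t.
  rewrite /g; case: ifP => // ne.
  by case: ifP => _; [apply: p_lt1 | apply: p_gt0].
have [eps eps_gt0 hg] := small_step h g_gt0.
have : P (p + eps *: a).
  apply/polytope_alt_formP => // e /eqP sz ne.
  have -> : alt_form e (p + eps *: a) = alt_form e p + eps * alt_form e a.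
    by rewrite linearD /= [alt_form e (eps *: a)]linearZ.
  have := hg (Tuple sz, false); have := hg (Tuple sz, true).
  rewrite /g /h /= ne; lra.
move=> /ab; rewrite linearD /= [dotp a (eps *: a)]linearZ /= apb gerDl.
by rewrite leNgt mulr_gt0 // dotp_gt0.
Qed.

(** The facet is contained in a slice of the same dimension, hence spans the
    same hyperplane, and a face is the part of the polytope in the flat that
    it spans. *)
Lemma facets_polytope (F : set 'rV[R]_n.+1) : faces P n F ->
  exists (e : n.-tuple bool) (c : bool), narrow l e /\ F = alt_slice l e c.
Proof.
move=> [[a [b [ab FE]]] dF].
have F0 : F !=set0.
  apply/set0P/eqP => F0; case: dF => x [U [_]]; rewrite F0 affine_hull0.
  by move=> /seteqP[_ /(_ x)]; apply; exists 0; rewrite /= ?mem0v ?addr0.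
have a0 : a != 0.
  apply/eqP => a0; have dot0 x : dotp a x = 0.
    by rewrite a0 /dotp big1 // => i _; rewrite mxE mul0r.
  have FP : F = P.
    rewrite FE; apply/seteqP; split=> [x []//|x Px]; split=> //=.
    case: F0 => y; rewrite FE => -[_ /=]; by rewrite !dot0.
  by have := has_dim_uniq dF; rewrite FP => /(_ _ (polytope_full R n l)); lia.
have [e [c [ne Fec]]] := tight_alt_form a0 ab FE F0.
exists e, c; split=> //; apply/seteqP; split=> // x Gx.
have aff : affine_hull F x.
  rewrite (affine_hull_eq dF (alt_slice_dim _ _ _ _ _) Fec).
  exact: sub_affine_hull.
rewrite FE; split; first by case: Gx.
by apply: affine_hull_hyperplane aff => y; rewrite FE => -[].
Qed.

Lemma face_number_facets :
  face_number n P = (2 * bit_count n (narrow l))%N.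
Proof.
pose A := finset.setX [set e : n.-tuple bool | narrow l e]%SET [set: bool]%SET.
rewrite /face_number [faces P n](_ : _ =
  [set alt_slice l (t.1 : n.-tuple bool) t.2 | t in [set t | t \in A]]).
  rewrite card_fset_image ?cardsX ?cardsT ?card_bool 1?mulnC //.
  move=> [e c] [e' c'] _ _ /=.
  move=> /alt_slice_inj; rewrite !size_tuple.
  by move=> /(_ erefl erefl)[/val_inj-> ->].
apply/seteqP; split=> F.
  move=> /facets_polytope[e [c [ne ->]]]; exists (e, c) => //=.
  by rewrite !inE ne.
move=> [[e c]] /=; rewrite !inE andbT => ne <-.
by apply: alt_slice_facet; rewrite ?size_tuple.
Qed.

Lemma updown_points01 x i : updown_points l x -> x 0 i = 0 \/ x 0 i = 1.
Proof. by case. Qed.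

Lemma polytope01 x i : P x -> 0 <= x 0 i <= 1.
Proof.
by move=> Px; rewrite -entry_ord (polytope_entry l_gt0 Px) // -ltnS.
Qed.

(** A face reduced to [x] contains every point that occurs with a nonzero
    weight in a convex combination giving [x]. Conversely a 0/1 point [v] is
    the only maximizer of [\sum_i (2 v_i - 1) x_i] over the unit cube. *)
Lemma vertices_polytope : faces P 0 = [set [set v] | v in updown_points l].
Proof.
apply/seteqP; split=> F.
  move=> [[a [b [ab FE]]] [x [U [/eqP]]]]; rewrite dimv_eq0 => /eqP-> hF.
  have {}hF : affine_hull F = [set x].
    rewrite hF; apply/seteqP; split=> [y [u /=] | y ->].
      by rewrite memv0 => /eqP-> <-; rewrite addr0.
    by exists 0; rewrite /= ?mem0v ?addr0.
  have Fx y : F y -> y = x by move=> /sub_affine_hull; rewrite hF.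
  have Fx0 : F x.
    have : F !=set0.
      apply/set0P/eqP => F0; move: hF; rewrite F0 affine_hull0 => /seteqP[_].
      by move=> /(_ x erefl).
    by move=> [y Fy]; rewrite -(Fx _ Fy).
  exists x; last by apply/seteqP; split=> [_ -> // | y /Fx ->].
  have [[N [p [c [Sp c0 c1 xE]]]] /= axb] : (P `&` [set x | dotp a x = b]) x.
    by rewrite -FE.
  have gap0 i : 0 <= c i * (b - dotp a (p i)).
    by rewrite mulr_ge0 // subr_ge0 ab //; apply: sub_convex_hull; apply: Sp.
  have : \sum_i c i * (b - dotp a (p i)) = 0.
    under eq_bigr do rewrite mulrBr.
    rewrite sumrB -mulr_suml c1 mul1r -axb xE linear_sum /=.
    by under [X in _ - X]eq_bigr do rewrite -linearZ /=; rewrite subrr.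
  move=> /psumr_eq0P gapE.
  have [i ci] : exists i, c i <> 0.
    apply: contrapT => nc; move: c1; rewrite big1 => [/esym/eqP|i _].
      by rewrite oner_eq0.
    by apply: contrapT => ci; apply: nc; exists i.
  have := gapE (fun i _ => gap0 i) i isT => /eqP; rewrite mulf_eq0.
  move=> /orP[/eqP // | ]; rewrite subr_eq0 => /eqP bi.
  have <- : p i = x; last exact: Sp.
  by apply: Fx; rewrite FE; split=> //; apply: sub_convex_hull; apply: Sp.
move=> [v Vv <-]; split; last first.
  exists v, 0%VS; rewrite dimv0; split=> //; apply/seteqP; split=> x /=.
    move=> [N [p [c [Sp c1 ->]]]]; exists 0; first by rewrite /= mem0v.
    rewrite addr0 (eq_bigr (fun i => c i *: v)) => [|i _]; last by rewrite Sp.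
    by rewrite -scaler_suml c1 scale1r.
  move=> [u]; rewrite /= memv0 => /eqP -> <-.
  by rewrite addr0; apply: sub_affine_hull.
pose a : 'rV[R]_n.+1 := \row_i (2 * v 0 i - 1).
have term x i : P x -> 0 <= v 0 i - a 0 i * x 0 i.
  move=> /(polytope01 i) /andP[x0 x1]; rewrite mxE.
  by have [->|->] := updown_points01 i Vv; lra.
have gapE x : \sum_i v 0 i - dotp a x = \sum_i (v 0 i - a 0 i * x 0 i).
  by rewrite sumrB.
have Pv : P v by exact: sub_convex_hull.
exists a, (\sum_i v 0 i); split=> [x Px|].
  by rewrite -subr_ge0 gapE sumr_ge0 // => i _; apply: term.
apply/seteqP; split=> x /=.
  move=> ->; split=> //; apply/eqP.
  rewrite eq_sym -subr_eq0 gapE big1 // => i _.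
  by rewrite mxE; have [->|->] := updown_points01 i Vv; ring.
move=> [Px axE]; apply/rowP => i.
have /psumr_eq0P H : \sum_i (v 0 i - a 0 i * x 0 i) = 0.
  by rewrite -gapE axE subrr.
have := H (fun i _ => term x i Px) i isT; rewrite mxE.
by have [->|->] := updown_points01 i Vv; lra.
Qed.

Definition bit_vec (t : n.+1.-tuple bool) : 'rV[R]_n.+1 :=
  \row_i (nth false t i)%:R.

Lemma bit_vec_inj : injective bit_vec.
Proof.
move=> s t /rowP E; apply/val_inj/(@eq_from_nth _ false).
  by rewrite !size_tuple.
move=> i; rewrite size_tuple => i_n.
have := E (Ordinal i_n); rewrite !mxE /= => /eqP; rewrite eqr_nat.
by case: nth; case: nth.
Qed.

Lemma updown_points_bits :
  updown_points l = [set bit_vec t | t in [set t | t \in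
    [set t : n.+1.-tuple bool | vertex_bits l t]%SET]].
Proof.
have entry_vec (t : n.+1.-tuple bool) j : (j <= n)%N ->
    entry (bit_vec t) j = (nth false t j)%:R.
  by move=> jn; rewrite (entry_row (fun j => (nth false t j)%:R)).
have main (t : n.+1.-tuple bool) :
    updown_points l (bit_vec t) <-> vertex_bits l t.
  have swE j : (j < n)%N -> (entry (bit_vec t) j <> entry (bit_vec t) j.+1) <->
      (nth false t j != nth false t j.+1).
    move=> jn; rewrite !entry_vec ?(ltnW jn) //.
    case: nth; case: nth; split=> //= H; try by case: H.
      by apply/eqP; rewrite oner_eq0.
    by apply/eqP; rewrite eq_sym oner_eq0.
  case: t / tupleP swE entry_vec => c s; set t := [tuple of c :: s] => swE _.
  have nthE j : (j < n)%N -> nth c (c :: s) j != nth c s j <->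
      (entry (bit_vec t) j <> entry (bit_vec t) j.+1).
    move=> jn; rewrite swE //=.
    rewrite (set_nth_default false) /= ?size_tuple ?ltnS ?(ltnW jn) //.
    by rewrite (set_nth_default false (s := s)) ?size_tuple.
  split.
    move=> /updown_pointsP[_ gap]; apply/dwellsP => //; rewrite size_tuple.
    split=> // i j [i_n swi] [j_n swj] ij.
    by apply: gap; rewrite ?ij //; apply/nthE.
  move=> /(dwellsP _ _ _ l_gt0); rewrite size_tuple => -[_ gap].
  apply/updown_pointsP; split=> [j jn | i j /andP[ij jn] swi swj].
    rewrite (entry_row (fun j => (nth false t j)%:R)) //.
    by case: nth; [right | left].
  apply: gap => //; split=> //; try by apply/nthE => //; apply: ltn_trans jn.
  exact: ltn_trans jn.
apply/seteqP; split=> x; last first.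
  by move=> [t] /=; rewrite inE => /main Vt <-.
move=> Vx; pose t := [tuple x 0 i == 1 | i < n.+1].
have xE : bit_vec t = x.
  apply/rowP => i; rewrite mxE -tnth_nth tnth_mktuple.
  by have [->|->] := updown_points01 i Vx; rewrite ?eqxx // eq_sym oner_eq0.
by exists t => //=; rewrite inE; apply/main; rewrite xE.
Qed.

(** An arbitrary injective [f] serves both the vertices, seen as singleton
    faces, and the images of the vertices under an affine bijection. *)
Lemma card_updown_points (U : choiceType) (f : 'rV[R]_n.+1 -> U) :
  set_inj (updown_points l) f ->
  #|` fset_set [set f x | x in updown_points l]| = (2 * dwell_count l n)%N.
Proof.
rewrite -bit_count_vertex updown_points_bits => f_inj.
rewrite image_comp card_fset_image // => s t sV tV /= E.
by apply: bit_vec_inj; apply: f_inj; rewrite ?inE //; apply: imageP.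
Qed.

Lemma face_number_vertices : face_number 0 P = (2 * dwell_count l n)%N.
Proof.
rewrite /face_number vertices_polytope card_updown_points // => x y _ _ E.
by have : [set y] x by rewrite -E.
Qed.

Lemma extreme_polytope : extreme P = updown_points l.
Proof.
apply/seteqP; split; first exact: extreme_hull.
move=> v Vv; split=> [|t y z /andP[t0 t1] Py Pz vE].
  exact: sub_convex_hull.
apply/rowP => i; have := congr1 (fun w : 'rV__ => w 0 i) vE; rewrite !mxE.
have /andP[y0 y1] := polytope01 i Py; have /andP[z0 z1] := polytope01 i Pz.
by have [->|->] := updown_points01 i Vv; nra.
Qed.

End Classification.

(** * The cube and the cross-polytope *)

Section Isomorphisms.
Local Open Scope classical_set_scope.
Local Open Scope ring_scope.
Variables (R : realType).

Lemma extreme_image (m n : nat) (S : set 'rV[R]_m) (T : set 'rV[R]_n)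
    (A : 'M[R]_(m, n)) (b : 'rV[R]_n) :
  (forall (t : R) y z, 0 < t < 1 -> S y -> S z -> S ((1 - t) *: y + t *: z)) ->
  set_bij S T (fun x => x *m A + b) ->
  [set x *m A + b | x in extreme S] = extreme T.
Proof.
move=> S_convex [fST f_inj f_surj].
have f_mid (t : R) y z : ((1 - t) *: y + t *: z) *m A + b =
    (1 - t) *: (y *m A + b) + t *: (z *m A + b).
  by rewrite mulmxDl -!scalemxAl !scalerDr addrACA -scalerDl subrK scale1r.
apply/seteqP; split=> [_ [x [Sx ext] <-] | y [Ty ext]].
  split=> [|t _ _ t01 /f_surj[y Sy <-] /f_surj[z Sz <-]]; first exact: fST.
  rewrite -f_mid => xE; rewrite (ext t y z) //.
  by apply: f_inj; rewrite ?inE //; apply: S_convex.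
have [x Sx xy] := f_surj _ Ty; exists x => //; split=> // t u v t01 Su Sv xE.
apply: f_inj; rewrite ?inE //; apply: (ext t) => //; try exact: fST.
by rewrite -f_mid -xE.
Qed.

(** The left-hand side depends on [T] only, hence so does [dwell_count l n]:
    this is the invariant that identifies [l]. *)
Lemma isomorphic_dwell_count (n l m : nat) (T : set 'rV[R]_m) : (0 < l)%N ->
  affinely_isomorphic (min_updown_polytope R n.+1 l) T ->
  #|` fset_set (extreme T)| = (2 * dwell_count l n)%N.
Proof.
move=> l_gt0 [A [b f_bij]].
have [_ f_inj _] := f_bij.
rewrite -(extreme_image _ f_bij) => [|t y z /andP[t0 t1] Py Pz].
  rewrite extreme_polytope // card_updown_points // => x y.
  move=> /set_mem Vx /set_mem Vy.
  by apply: f_inj; rewrite inE; apply: sub_convex_hull.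
apply/polytope_alt_formP => // e sz ne.
have /andP[y0 y1] := (polytope_alt_formP _ l_gt0).1 Py e sz ne.
have /andP[z0 z1] := (polytope_alt_formP _ l_gt0).1 Pz e sz ne.
have -> : alt_form e ((1 - t) *: y + t *: z) =
    (1 - t) * alt_form e y + t * alt_form e z.
  rewrite linearD /= [alt_form e (t *: z)]linearZ.
  by rewrite [alt_form e (_ *: y)]linearZ.
by nra.
Qed.

Lemma isomorphic_cube (n : nat) :
  affinely_isomorphic (min_updown_polytope R n.+1 1) (cube R n.+1).
Proof.
exists 2%:M, (const_mx (-1)); have fE (x : 'rV[R]_n.+1) i :
    (x *m 2%:M + const_mx (-1)) 0 i = 2 * x 0 i - 1.
  by rewrite mul_mx_scalar !mxE.
have PE (x : 'rV[R]_n.+1) :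
    (forall i, 0 <= x 0 i <= 1) -> min_updown_polytope R n.+1 1 x.
  move=> x01; apply/polytope_windowed => //; split=> r s rsn sr;
    have /andP[_ sn] := rsn; have /andP[s0 s1] := x01 (inord s);
    have [rs | sr'] := ltnP r s; try (rewrite big_geq // /flip /entry; lra).
    have -> : s = r.+1 by lia.
    rewrite big_nat1 /rise ge_max /entry.
    by have := x01 (inord r.+1); have := x01 (inord r); lra.
  have -> : s = r.+1 by lia.
  rewrite big_nat1 /rise /flip ge_max /entry.
  by have := x01 (inord r.+1); have := x01 (inord r); lra.
split=> [x Px i | x y _ _ /rowP E | y Cy].
- by rewrite fE; have := polytope01 (leqnn 1) i Px; lra.
- by apply/rowP => i; have := E i; rewrite !fE; lra.
exists (2^-1 *: (y + const_mx 1)); last first.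
  by apply/rowP => i; rewrite fE !mxE; field.
by apply: PE => i; rewrite !mxE; have := Cy i; lra.
Qed.

Lemma cross_polytopeP (d : nat) (y : 'rV[R]_d) :
  cross_polytope R d y <-> \sum_i `|y 0 i| <= 1.
Proof.
split=> [Cy | y1 x Cx].
  have -> : \sum_i `|y 0 i| = dotp y (\row_i Num.sg (y 0 i)).
    by apply: eq_bigr => i _; rewrite mxE normrEsg mulrC.
  apply: Cy => i; rewrite mxE.
  by case: sgrP => _; lra.
apply: le_trans y1; apply: ler_sum => i _; apply: le_trans (ler_norm _) _.
by rewrite normrM ler_piMr // ler_norml; apply: Cx.
Qed.

(** With a single window covering everything, the condition on the whole
    sequence implies the others, since [f n - f s] is at most the rises after
    [s]. *)
Lemma rises_bounded_full (n : nat) (f : nat -> R) :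
  \sum_(0 <= j < n) rise f j <= f n -> rises_bounded n n f.
Proof.
move=> fn r s /andP[rs sn] _; move: fn.
rewrite (big_cat_nat (leq0n s) sn) //= (big_cat_nat (leq0n r) rs) //=.
have : 0 <= \sum_(0 <= j < r) rise f j.
  by apply: sumr_ge0 => j _; apply: rise_ge0.
have : f n - f s <= \sum_(s <= j < n) rise f j.
  rewrite -(telescope_sumr f sn); apply: ler_sum => j _.
  by rewrite /rise le_max lexx.
lra.
Qed.

Lemma rise_abs (f : nat -> R) j :
  rise f j + rise (flip f) j = `|f j.+1 - f j|.
Proof.
rewrite /rise /flip (_ : 1 - _ - _ = - (f j.+1 - f j)); last by ring.
by case: (ger0P (f j.+1 - f j)) => h; case: (lerP (f j.+1 - f j) 0) => h1;
  case: (lerP (- (f j.+1 - f j)) 0) => h2; lra.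
Qed.

(** The linear part of the map sending the pair made of [tail i] and its
    complement to the pair of opposite vertices [e_i] and [- e_i]: the
    differences of [tail i] detect the place of its step, and the sum of the
    first and last entries, minus 1, vanishes unless the point is constant. *)
Definition cross_map (n : nat) (x : 'rV[R]_n.+1) : 'rV[R]_n.+1 :=
  \row_j (if unlift ord0 j is Some i then entry x i.+1 - entry x i
          else entry x 0 + entry x n).

Fact cross_map_is_linear n : linear (@cross_map n).
Proof.
move=> a x y; apply/rowP => j; rewrite !mxE.
by case: unlift => [i|]; rewrite /entry !mxE; ring.
Qed.
HB.instance Definition _ n :=
  GRing.isLinear.Build R 'rV[R]_n.+1 'rV[R]_n.+1 _ (@cross_map n)
    (@cross_map_is_linear n).

(** With [up] and [dn] the total rise and fall of [x], so that
    [up - dn = x_n - x_0], the image of [x] has norm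
    [|x_0 + x_n - 1| + up + dn], which is at
    most 1 exactly when [up <= x_n] and [dn <= 1 - x_n]. *)
Lemma isomorphic_cross (n : nat) : (0 < n)%N ->
  affinely_isomorphic (min_updown_polytope R n.+1 n) (cross_polytope R n.+1).
Proof.
move=> n_gt0; pose b : 'rV[R]_n.+1 := - delta_mx 0 ord0.
exists (lin1_mx (@cross_map n)), b.
pose f (x : 'rV[R]_n.+1) := cross_map x + b.
have fE x : x *m lin1_mx (@cross_map n) + b = f x by rewrite mul_rV_lin1.
have f0 x : f x 0 ord0 = entry x 0 + entry x n - 1.
  by rewrite !mxE unlift_none !eqxx.
have fS x i : f x 0 (lift ord0 i) = entry x i.+1 - entry x i.
  by rewrite !mxE liftK eq_sym (negbTE (neq_lift _ _)) andbF subr0.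
have normE x : \sum_i `|f x 0 i| = `|entry x 0 + entry x n - 1| +
    \sum_(0 <= j < n) rise (entry x) j +
    \sum_(0 <= j < n) rise (flip (entry x)) j.
  rewrite big_ord_recl f0 -[RHS]addrA -big_split big_mkord; congr (_ + _).
  by apply: eq_bigr => i _; rewrite fS /= rise_abs.
have riseE (x : 'rV[R]_n.+1) : \sum_(0 <= j < n) rise (entry x) j -
    \sum_(0 <= j < n) rise (flip (entry x)) j = entry x n - entry x 0.
  rewrite -sumrB -(telescope_sumr (entry x) (leq0n n)).
  by apply: eq_bigr => j _; rewrite rise_flip.
have PE x : min_updown_polytope R n.+1 n x <-> \sum_i `|f x 0 i| <= 1.
  rewrite (polytope_windowed _ n_gt0) normE; have := riseE x.
  set up := \sum_(0 <= j < n) rise (entry x) j.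
  set dn := \sum_(0 <= j < n) rise _ j => updn; split=> [[bf bg] | le1].
    have := bf 0%N n; have := bg 0%N n.
    rewrite leqnn subn0 leqnn -/up -/dn => /(_ isT isT) h1 /(_ isT isT) h2.
    move: h1 h2; rewrite /flip; case: (ger0P (entry x 0 + entry x n - 1)); lra.
  by split; apply: rises_bounded_full; rewrite -/up -/dn;
    move: le1; rewrite /flip;
    case: (ger0P (entry x 0 + entry x n - 1)); lra.
split=> [x /PE fx | x y _ _ | y /cross_polytopeP Cy].
- by apply/cross_polytopeP; rewrite fE.
- rewrite !fE => /rowP E; apply: entryP.
  have D j : (j <= n)%N -> entry x j - entry x 0 = entry y j - entry y 0.
    elim: j => [|j IHj] jn; first by rewrite !subrr.
    have := IHj (ltnW jn); have := E (lift ord0 (Ordinal jn)).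
    by rewrite !fS /=; lra.
  have := E ord0; rewrite !f0; have := D n (leqnn n) => Dn E0 j jn.
  by have := D j jn; lra.
pose s j := \sum_(0 <= i < j) entry y i.+1.
(* [s j] prescribes the differences of [x]; the constant makes the first and
   last entries sum to [1 + y_0]. *)
pose x : 'rV[R]_n.+1 := \row_j ((1 + entry y 0 - s n) / 2 + s j).
have xE j : (j <= n)%N -> entry x j = (1 + entry y 0 - s n) / 2 + s j.
  by move=> jn; rewrite (entry_row (fun j => (1 + entry y 0 - s n) / 2 + s j)).
have fxy : f x = y.
  apply/rowP => j; case: (unliftP ord0 j) => [i|] ->.
    rewrite fS !xE ?(ltnW (ltn_ord i)) //.
    rewrite [s i.+1]/s big_nat_recr //= -/(s i) -[in RHS]entry_ord /=; lra.
  rewrite f0 !xE // -[in RHS]entry_ord [s 0%N]/s big_geq //=.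
  by field.
by exists x; [apply/PE; rewrite fxy | rewrite /= fE].
Qed.

End Isomorphisms.

(** * The bound and its equality cases *)

Theorem lemma10 (R : realType) (d l : nat) (l_gt0 : (0 < l)%N)
    (l_lt_d : (l < d)%N) :
  let P := min_updown_polytope R d l in
  [/\ has_dim P d,
      (face_number 0 P * face_number d.-1 P <= d * 2 ^ d.+1)%N
    & (face_number 0 P * face_number d.-1 P = d * 2 ^ d.+1)%N <->
      affinely_isomorphic P (cube R d) \/
      affinely_isomorphic P (cross_polytope R d)].
Proof.
case: d l_lt_d => // n; rewrite ltnS => l_le_n P.
have n_gt0 : 0 < n by apply: leq_trans l_le_n.
have bound : face_number 0 P * face_number n P <= n.+1 * 2 ^ n.+2
    ?= iff (l == 1) || (l == n).
  rewrite face_number_vertices // face_number_facets //.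
  case: l l_gt0 l_le_n {P} => // l _ l_le_n.
  have := dwell_count_bound l (n - l.+1); rewrite subnKC // => B.
  have -> : bit_count n (narrow l.+1) = (n - l.+1).+2 * 2 ^ l.
    by rewrite -bit_count_narrow subnKC.
  (* Both sides of the bound lose the common factor [k]. *)
  pose k := 2 ^ l.+2; have k_gt0 : 0 < k by rewrite expn_gt0.
  have -> : 2 * dwell_count l.+1 n * (2 * ((n - l.+1).+2 * 2 ^ l)) =
      k * (dwell_count l.+1 n * (n - l.+1).+2) by rewrite /k !expnS; lia.
  have -> : n.+1 * 2 ^ n.+2 = k * ((l + (n - l.+1)).+2 * 2 ^ (n - l.+1).+1).
    by rewrite mulnCA -expnD; congr (_ * 2 ^ _); lia.
  split; first by rewrite leq_pmul2l // B.
  by rewrite eqn_pmul2l // B; congr (_ || _); lia.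
split; first exact: polytope_full.
  exact: bound.1.
rewrite /=; split=> [/eqP | iso].
  rewrite bound.2 => /orP[]/eqP lE; rewrite /P lE; [left | right].
    exact: isomorphic_cube.
  exact: isomorphic_cross.
apply/eqP; rewrite bound.2; case: iso => /(isomorphic_dwell_count l_gt0).
  rewrite (isomorphic_dwell_count _ (isomorphic_cube R n)) //.
  rewrite dwell_count1 => E; apply/orP; left.
  by have := @dwell_count_lt l n; lia.
rewrite (isomorphic_dwell_count _ (isomorphic_cross R n_gt0)) //.
have -> : dwell_count n n = n.+1.
  by case: n n_gt0 {l_le_n P bound} => // n _; rewrite dwell_count_small.
by have := @dwell_count_gt l n; lia.
Qed.
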